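(* Let $(\mathcal{X},P)$ be a finite irreducible Markov chain. For every $\varepsilon\in(0,1)$, $$\mathrm{diam}(\mathcal{X})\le(1+k_{(\mathcal{X},P)})\left(t_{\mathrm{mix}}(\varepsilon)+\sqrt{\frac{2\,t_{\mathrm{mix}}(\varepsilon)}{1-\varepsilon}}+k_{(\mathcal{X},P)}\sqrt{\frac{t_{\mathrm{rel}}}{1-\varepsilon}}\right).$$
   Context: A finite irreducible Markov chain $(\mathcal{X},P)$ consists of a finite set $\mathcal{X}$ with $|\mathcal{X}|\ge2$ and an irreducible stochastic matrix $P$ on $\mathcal{X}$ (no symmetry of the support assumed), with stationary distribution $\pi$. $\mathscr{P}_t(x,y)=e^{-t}\sum_{m\ge0}\frac{t^m}{m!}P^m(x,y)$; $\|\mu_1-\mu_2\|_{\mathrm{TV}}=\frac12\sum_x|\mu_1(x)-\mu_2(x)|$; $t_{\mathrm{mix}}(\varepsilon)=\inf\{t\ge0:\max_x\|\mathscr{P}_t(x,\cdot)-\pi\|_{\mathrm{TV}}\le\varepsilon\}$. $\mathcal{E}(f)=\frac12\sum_{x,y}\pi(x)P(x,y)(f(x)-f(y))^2$, and $t_{\mathrm{rel}}=\sup\{\mathrm{Var}_\pi(f)/\mathcal{E}(f):f:\mathcal{X}\to\mathbb{R},\ \mathcal{E}(f)>0\}$, where $\mathrm{Var}_\pi$ is the variance under $\pi$. $d_P(x\to y)=\min\{k\in\mathbb{N}_0:P^k(x,y)>0\}$ (with $P^0=I$); $k_{(\mathcal{X},P)}=\max\{d_P(y\to x):d_P(x\to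 y)=1\}$; $\mathrm{diam}(\mathcal{X})=\max\{d_P(x\to y):x,y\in\mathcal{X}\}$. *)

(* Defs.v *)
From HB Require Import structures.
From mathcomp Require Import all_boot all_order all_algebra.
From mathcomp Require Import all_classical all_reals all_analysis.
Set Implicit Arguments.
Unset Strict Implicit.
Unset Printing Implicit Defensive.
Import Order.TTheory GRing.Theory Num.Theory.
Import numFieldNormedType.Exports.
Local Open Scope classical_set_scope.
Local Open Scope ring_scope.

Definition stochastic (R : realType) (X : finType) (P : X -> X -> R) : Prop :=
  (forall x y, 0 <= P x y) /\ (forall x, \sum_y P x y = 1).

Fixpoint kernel_pow (R : realType) (X : finType) (P : X -> X -> R)
    (m : nat) (x y : X) : R :=
  if m is m'.+1 then \sum_z P x z * kernel_pow P m' z y else (x == y)%:R.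

Definition irreducible (R : realType) (X : finType) (P : X -> X -> R) : Prop :=
  forall x y, exists m, 0 < kernel_pow P m x y.

Definition stationary_distribution (R : realType) (X : finType)
    (P : X -> X -> R) (pi : X -> R) : Prop :=
  [/\ forall x, 0 <= pi x,
      \sum_x pi x = 1 &
      forall y, \sum_x pi x * P x y = pi y].

Definition heat_kernel (R : realType) (X : finType) (P : X -> X -> R)
    (t : R) (x y : X) : R :=
  expR (- t) * limn (series (fun m => t ^+ m / m`!%:R * kernel_pow P m x y)).

Definition tv_dist (R : realType) (X : finType) (mu1 mu2 : X -> R) : R :=
  2^-1 * \sum_x `|mu1 x - mu2 x|.

(* The default value 0 of the maximum is harmless: the distances are
   nonnegative. *)
Definition tmix (R : realType) (X : finType) (P : X -> X -> R) (pi : X -> R)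
    (eps : R) : R :=
  inf [set t : R | 0 <= t /\
    \big[Num.max/0]_(x : X) tv_dist (heat_kernel P t x) pi <= eps].

Definition dirichlet (R : realType) (X : finType) (P : X -> X -> R)
    (pi : X -> R) (f : X -> R) : R :=
  2^-1 * \sum_x \sum_y pi x * P x y * (f x - f y) ^+ 2.

Definition mean (R : realType) (X : finType) (pi : X -> R) (f : X -> R) : R :=
  \sum_x pi x * f x.

Definition var (R : realType) (X : finType) (pi : X -> R) (f : X -> R) : R :=
  \sum_x pi x * (f x - mean pi f) ^+ 2.

(* [inf] and [sup] are totalized at 0, which never matters for an irreducible
   chain on at least two states: the set in [tmix] is nonempty by convergence
   to equilibrium, and the set in [trel] is nonempty and bounded above by the
   Poincare inequality. *)
Definition trel (R : realType) (X : finType) (P : X -> X -> R)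
    (pi : X -> R) : R :=
  sup [set var pi f / dirichlet P pi f |
        f in [set f : X -> R | 0 < dirichlet P pi f]].

Definition dist (R : realType) (X : finType) (P : X -> X -> R)
    (irr : irreducible P) (x y : X) : nat :=
  ex_minn (irr x y).

Definition kconst (R : realType) (X : finType) (P : X -> X -> R)
    (irr : irreducible P) : nat :=
  \max_(xy : X * X | dist irr xy.1 xy.2 == 1%N) dist irr xy.2 xy.1.

Definition chain_diam (R : realType) (X : finType) (P : X -> X -> R)
    (irr : irreducible P) : nat :=
  \max_(xy : X * X) dist irr xy.1 xy.2.

(* Main.v *)
(* A walk that jumps m times moves at most m steps away from its start x, and
   the number of jumps before time t is Poisson(t). Hence at a time t at which
   the walk is eps-mixed, a set of stationary mass at least (1 - eps) / 2 lies
   within t + sqrt (2 t / (1 - eps)) of x. With k = kconst, the function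
   d(x -> .) changes by at most k along an edge, so its variance is at most
   trel * k^2 / 2, and by Chebyshev's inequality the previous bound controls its
   mean. Finally d(x -> y) <= d(x -> z) + k d(y -> z), which is averaged over z
   under pi.

   The set of eps-mixed times must be shown nonempty. Solving Poisson's equation
   g - pi(g) = h - P h, summation by parts against the Poisson weights gives
   |P_t g - pi(g)| <= sup |h| / sqrt t. *)

Require Import Defs.
From HB Require Import structures.
From mathcomp Require Import all_boot all_order all_algebra.
From mathcomp Require Import all_classical all_reals all_analysis.
From mathcomp Require Import ring lra.
Set Implicit Arguments.
Unset Strict Implicit.
Unset Printing Implicit Defensive.
Import Order.TTheory GRing.Theory Num.Theory.
Import numFieldNormedType.Exports.
Local Open Scope classical_set_scope.
Local Open Scope ring_scope.

(** * Kernel powers and the directed distance *)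

Section KernelPowers.
Variables (R : realType) (X : finType) (P : X -> X -> R).
Hypothesis hP : stochastic P.

Lemma kernel_pow_ge0 m x y : 0 <= kernel_pow P m x y.
Proof.
elim: m x => [|m IH] x /=; first exact: ler0n.
by apply: sumr_ge0 => z _; rewrite mulr_ge0 //; case: hP.
Qed.

Lemma sum_delta (f : X -> R) x : \sum_y (x == y)%:R * f y = f x.
Proof.
rewrite (bigD1 x) //= eqxx mul1r big1 ?addr0 // => y /negPf.
by rewrite eq_sym => ->; rewrite mul0r.
Qed.

Lemma kernel_powD m n x y :
  kernel_pow P (m + n) x y =
  \sum_z kernel_pow P m x z * kernel_pow P n z y.
Proof.
elim: m x => [|m IH] x /=; first by rewrite add0n sum_delta.
under eq_bigr do rewrite IH mulr_sumr.
rewrite exchange_big /=; apply: eq_bigr => z _.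
by rewrite mulr_suml; apply: eq_bigr => u _; rewrite mulrA.
Qed.

Lemma kernel_pow1 x y : kernel_pow P 1 x y = P x y.
Proof.
rewrite /=; under eq_bigr do rewrite mulrC eq_sym.
exact: sum_delta.
Qed.

Lemma kernel_powSr m x y :
  kernel_pow P m.+1 x y = \sum_z kernel_pow P m x z * P z y.
Proof.
rewrite -addn1 kernel_powD.
by apply: eq_bigr => z _; rewrite kernel_pow1.
Qed.

Lemma kernel_pow_sum1 m x : \sum_y kernel_pow P m x y = 1.
Proof.
elim: m x => [|m IH] x.
  rewrite -[RHS](sum_delta (fun=> 1) x).
  by apply: eq_bigr => y _; rewrite mulr1.
rewrite /= exchange_big /=; under eq_bigr do rewrite -mulr_sumr IH mulr1.
by case: hP.
Qed.

Lemma kernel_pow_le1 m x y : kernel_pow P m x y <= 1.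
Proof.
rewrite -(kernel_pow_sum1 m x) (bigD1 y) //= lerDl.
by apply: sumr_ge0 => z _; exact: kernel_pow_ge0.
Qed.

Lemma kernel_powD_gt0 m n x y z : 0 < kernel_pow P m x y ->
  0 < kernel_pow P n y z -> 0 < kernel_pow P (m + n) x z.
Proof.
move=> hm hn; rewrite kernel_powD (bigD1 y) //= ltr_pwDl ?mulr_gt0 //.
by apply: sumr_ge0 => u _; rewrite mulr_ge0 ?kernel_pow_ge0.
Qed.

Lemma kernel_powS_gt0 m x z : 0 < kernel_pow P m.+1 x z ->
  exists2 y, 0 < P x y & 0 < kernel_pow P m y z.
Proof.
move=> /= h; have [y /= hy] : exists y, 0 < P x y * kernel_pow P m y z.
  apply/not_existsP => hn; move: h; rewrite ltNge => /negP; apply.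
  by apply: sumr_le0 => y _; rewrite leNgt; apply/negP; exact: hn.
have [P0 _] := hP.
have hxy : 0 < P x y.
  rewrite lt0r P0 andbT; apply/negP => /eqP h0; move: hy.
  by rewrite h0 mul0r ltxx.
by exists y => //; move: hy; rewrite pmulr_rgt0.
Qed.

Hypothesis irr : irreducible P.

Lemma dist_gt0 x y : 0 < kernel_pow P (dist irr x y) x y.
Proof. by rewrite /dist; case: ex_minnP. Qed.

Lemma dist_le m x y : 0 < kernel_pow P m x y -> (dist irr x y <= m)%N.
Proof. by move=> h; rewrite /dist; case: ex_minnP => d _; apply. Qed.

Lemma dist_triangle y x z : (dist irr x z <= dist irr x y + dist irr y z)%N.
Proof. by apply: dist_le; apply: kernel_powD_gt0; exact: dist_gt0. Qed.

Lemma distxx x : dist irr x x = 0%N.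
Proof. by apply/eqP; rewrite -leqn0; apply: dist_le; rewrite /= eqxx ltr01. Qed.

Lemma dist_eq0 x y : dist irr x y = 0%N -> x = y.
Proof.
have := dist_gt0 x y => /[swap] -> /=.
by case: eqP => // _; rewrite ltxx.
Qed.

Lemma dist_step x y : x != y -> 0 < P x y -> dist irr x y = 1%N.
Proof.
move=> xy Pxy; apply/eqP; rewrite eqn_leq dist_le ?kernel_pow1 //=.
rewrite lt0n; apply/negP => /eqP /dist_eq0 e; move: xy.
by rewrite e eqxx.
Qed.

Lemma dist_back x y : 0 < P x y -> (dist irr y x <= kconst irr)%N.
Proof.
move=> Pxy; have [->|xy] := eqVneq x y; first by rewrite distxx.
rewrite /kconst; apply: (@leq_bigmax_cond _ _
  (fun xy : X * X => dist irr xy.2 xy.1) (x, y)).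
by rewrite /= dist_step.
Qed.

(** Each edge of a path from [x] to [y] can be undone in at most [kconst irr] steps. The induction
    runs over any path length of positive weight, not only the shortest. *)
Lemma dist_reverse x y : (dist irr y x <= kconst irr * dist irr x y)%N.
Proof.
have [m hm] : exists m, dist irr x y = m by exists (dist irr x y).
have := dist_gt0 x y; rewrite hm => {hm}.
elim: m x => [|m IH] x.
  by rewrite /=; case: eqP => [->|]; rewrite ?ltxx // distxx.
move=> /kernel_powS_gt0 [z Pxz /IH hz].
apply: leq_trans (dist_triangle z y x) _.
by rewrite mulnS addnC leq_add // dist_back.
Qed.

Lemma dist_lipschitz x z w : 0 < P z w ->
  ((dist irr x z)%:R - (dist irr x w)%:R) ^+ 2 <= (kconst irr)%:R ^+ 2 :> R.
Proof.
move=> Pzw; have [->|zw] := eqVneq z w.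
  by rewrite subrr expr0n /= sqr_ge0.
(* Returning along a nontrivial edge takes at least one step, so [kconst irr] also bounds the
   forward step of length 1. *)
have k1 : (1 <= kconst irr)%N.
  apply: leq_trans (dist_back Pzw); rewrite lt0n; apply/negP => /eqP.
  by move/dist_eq0 => e; move: zw; rewrite e eqxx.
have h1 : (dist irr x w <= dist irr x z + kconst irr)%N.
  apply: leq_trans (dist_triangle z x w) _.
  by rewrite leq_add2l (dist_step zw Pzw).
have h2 : (dist irr x z <= dist irr x w + kconst irr)%N.
  by apply: leq_trans (dist_triangle w x z) _; rewrite leq_add2l dist_back.
rewrite -subr_ge0 subr_sqr.
move: h1 h2; rewrite -!(ler_nat R) !natrD => h1 h2.
by rewrite mulr_ge0 //; lra.
Qed.

End KernelPowers.

(** * Dirichlet form, Poincare inequality and Poisson's equation *)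

Section DirichletForm.
Variables (R : realType) (X : finType) (P : X -> X -> R) (pi : X -> R).
Hypothesis hP : stochastic P.
Hypothesis irr : irreducible P.
Hypothesis hpi : stationary_distribution P pi.

Lemma stationary_kernel_pow m y : \sum_x pi x * kernel_pow P m x y = pi y.
Proof.
elim: m y => [|m IH] y.
  rewrite -[RHS](sum_delta pi y).
  by apply: eq_bigr => x _; rewrite /= eq_sym mulrC.
under eq_bigr do rewrite kernel_powSr mulr_sumr.
rewrite exchange_big /=.
under eq_bigr => z _.
  under eq_bigr do rewrite mulrA.
  rewrite -mulr_suml IH.
  over.
by case: hpi.
Qed.

Lemma stationary_mean f : \sum_x pi x * (\sum_y P x y * f y) = mean pi f.
Proof.
under eq_bigr do rewrite mulr_sumr.
rewrite exchange_big /=; apply: eq_bigr => y _.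
under eq_bigr do rewrite mulrA.
by rewrite -mulr_suml; case: hpi => _ _ ->.
Qed.

Lemma stationary_gt0 y : 0 < pi y.
Proof.
have [pi0 pi1 _] := hpi.
have [x hx] : exists x, 0 < pi x.
  apply/not_existsP => hn; have := @ltr01 R; rewrite -pi1 ltNge => /negP; apply.
  by apply: sumr_le0 => x _; rewrite leNgt; apply/negP; exact: hn.
have [m hm] := irr x y; rewrite -(stationary_kernel_pow m y) (bigD1 x) //=.
rewrite ltr_pwDl ?mulr_gt0 //; apply: sumr_ge0 => z _.
by rewrite mulr_ge0 ?kernel_pow_ge0.
Qed.

Lemma dirichlet_ge0 f : 0 <= dirichlet P pi f.
Proof.
have [[P0 _] [pi0 _ _]] := (hP, hpi).
rewrite mulr_ge0 ?invr_ge0 ?ler0n //; do 2!apply: sumr_ge0 => ? _.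
by rewrite mulr_ge0 ?sqr_ge0 // mulr_ge0.
Qed.

Lemma dirichlet_edge f x y :
  pi x * P x y * (f x - f y) ^+ 2 <= 2 * dirichlet P pi f.
Proof.
have [[P0 _] [pi0 _ _]] := (hP, hpi).
rewrite /dirichlet mulVKf ?pnatr_eq0 // (bigD1 x) //= (bigD1 y) //= -addrA.
rewrite lerDl addr_ge0 ?sumr_ge0 // => z _; last apply: sumr_ge0 => ? _;
  by rewrite mulr_ge0 ?sqr_ge0 // mulr_ge0.
Qed.

(** Sum the increments along a path of positive weight, each edge being controlled by the energy.
    The crude constant only serves to show that [trel] is finite and that zero energy forces
    constancy. *)
Lemma dirichlet_pair x y : exists2 C, 0 <= C &
  forall f, (f x - f y) ^+ 2 <= C * dirichlet P pi f.
Proof.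
have [m] := irr x y; elim: m x => [|m IH] x.
  rewrite /=; case: eqP => [->|]; last by rewrite ltxx.
  by exists 0 => // f; rewrite subrr expr0n /= mul0r.
move=> /(kernel_powS_gt0 hP) [z Pxz /IH [C C0 hC]].
have w0 : 0 < pi x * P x z by rewrite mulr_gt0 // stationary_gt0.
(* By (a + b)^2 <= 2 a^2 + 2 b^2, both the edge bound [2 / (pi x * P x z)] and [C] get doubled. *)
exists (4 / (pi x * P x z) + 2 * C) => [|f].
  by rewrite addr_ge0 ?mulr_ge0 ?invr_ge0 // ltW.
have h1 : (f x - f z) ^+ 2 <= 2 / (pi x * P x z) * dirichlet P pi f.
  by rewrite mulrAC ler_pdivlMr // mulrC dirichlet_edge.
have h2 := hC f; have h3 := sqr_ge0 ((f x - f z) - (f z - f y)).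
set a := (pi x * P x z)^-1 in h1 *.
nra.
Qed.

(** Bias-variance decomposition: the two sides differ by the square of [mean pi f - c]. *)
Lemma var_le_dev f c : var pi f <= \sum_x pi x * (f x - c) ^+ 2.
Proof.
have [pi0 pi1 _] := hpi.
have -> : \sum_x pi x * (f x - c) ^+ 2 = var pi f + (mean pi f - c) ^+ 2.
  have -> : (mean pi f - c) ^+ 2 = \sum_x pi x * ((mean pi f - c) ^+ 2
      + 2 * (mean pi f - c) * (f x - mean pi f)).
    under eq_bigr do rewrite mulrDr.
    rewrite big_split /= -mulr_suml pi1 mul1r.
    under eq_bigr => x _ do rewrite mulrCA (mulrBr (pi x)).
    by rewrite -mulr_sumr sumrB -mulr_suml pi1 mul1r subrr mulr0 addr0.
  by rewrite -big_split /=; apply: eq_bigr => x _; ring.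
by rewrite lerDl sqr_ge0.
Qed.

Lemma poincare : exists2 C, 0 <= C &
  forall f, var pi f <= C * dirichlet P pi f.
Proof.
have [pi0 pi1 _] := hpi.
have [x0 _|hX] := pickP (xpredT : pred X); last first.
  by exists 0 => // f; rewrite mul0r /var big_pred0.
have /choice [C hC] y : exists C, 0 <= C /\
    forall f, (f y - f x0) ^+ 2 <= C * dirichlet P pi f.
  by have [C ? ?] := dirichlet_pair y x0; exists C.
exists (\sum_y pi y * C y) => [|f].
  by apply: sumr_ge0 => y _; rewrite mulr_ge0 //; case: (hC y).
apply: le_trans (var_le_dev f (f x0)) _.
rewrite mulr_suml; apply: ler_sum => y _; rewrite -mulrA ler_wpM2l //.
by case: (hC y).
Qed.

(** For positive energy the quotient lies below the supremum, which [poincare] makes finite; for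
    zero energy [poincare] bounds the variance by 0 directly. *)
Lemma var_le_trel f : var pi f <= trel P pi * dirichlet P pi f.
Proof.
have [C C0 hC] := poincare.
have := dirichlet_ge0 f; rewrite le_eqVlt => /orP[/eqP E0|E0].
  by rewrite -E0 mulr0 (le_trans (hC f)) // -E0 mulr0.
rewrite -ler_pdivrMr //; apply: ub_le_sup; last by exists f.
exists C => _ [g /= g0 <-]; rewrite ler_pdivrMr //; exact: hC.
Qed.

Lemma trel_ge0 : 0 <= trel P pi.
Proof.
have [pi0 _ _] := hpi.
have [[f f0]|h0] := pselect (exists f, 0 < dirichlet P pi f).
  rewrite -(pmulr_lge0 _ f0); apply: le_trans (var_le_trel f).
  by apply: sumr_ge0 => x _; rewrite mulr_ge0 ?sqr_ge0.
rewrite /trel (_ : [set f | 0 < _] = set0) ?image_set0 ?sup0 //.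
by apply/seteqP; split => // f /= f0; apply: h0; exists f.
Qed.

Lemma dirichlet_le f k :
  (forall x y, 0 < P x y -> (f x - f y) ^+ 2 <= k) -> dirichlet P pi f <= k / 2.
Proof.
have [[P0 P1] [pi0 pi1 _]] := (hP, hpi).
move=> hk; rewrite mulrC ler_wpM2l ?invr_ge0 //.
rewrite -[k]mul1r -[in leRHS]pi1 mulr_suml; apply: ler_sum => x _.
rewrite -[leRHS]mulr1 -(P1 x) mulr_sumr; apply: ler_sum => y _.
rewrite -!mulrA ler_wpM2l // mulrC.
have := P0 x y; rewrite le_eqVlt => /orP[/eqP <-|Pxy]; first by rewrite !mulr0.
by rewrite ler_wpM2r ?hk.
Qed.

(** After expanding the square, harmonicity turns the inner sum at [x] into P(h^2) - h^2, whose
    stationary mean is zero. *)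
Lemma dirichlet_harmonic h :
  (forall x, \sum_y P x y * h y = h x) -> dirichlet P pi h = 0.
Proof.
move=> hh; have [[P0 P1] [pi0 pi1 _]] := (hP, hpi).
rewrite /dirichlet (_ : \sum_x _ =
  \sum_x (pi x * (\sum_y P x y * (h y) ^+ 2) - pi x * (h x) ^+ 2)).
  rewrite sumrB stationary_mean subrr mulr0 //.
apply: eq_bigr => x _; rewrite -mulrBr.
under eq_bigr do rewrite -mulrA.
rewrite -mulr_sumr; congr (_ * _).
transitivity (\sum_y (P x y * h y ^+ 2 + P x y * h x ^+ 2
   - 2 * h x * (P x y * h y))); first by apply: eq_bigr => y _; ring.
by rewrite sumrB big_split /= -mulr_suml P1 -mulr_sumr hh; ring.
Qed.

Lemma harmonic_const h x y :
  (forall x, \sum_y P x y * h y = h x) -> h x = h y.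
Proof.
move=> /dirichlet_harmonic h0; have [C _ /(_ h)] := dirichlet_pair x y.
rewrite h0 mulr0 => h2; apply/eqP.
by rewrite -subr_eq0 -sqrf_eq0 eq_le h2 sqr_ge0.
Qed.

(* The operator [h |-> h - P h + pi h] is injective by the maximum principle,
   hence surjective; applying [pi] to its value identifies [pi h] with the mean
   of [g]. *)
Lemma poisson_equation g :
  exists h, forall x, g x - mean pi g = h x - \sum_y P x y * h y.
Proof.
have [[P0 P1] [pi0 pi1 _]] := (hP, hpi).
pose n := #|X|.
pose T (h : X -> R) x := h x - \sum_y P x y * h y + mean pi h.
have meanT h : mean pi (T h) = mean pi h.
  rewrite /mean /T; under eq_bigr do rewrite mulrDr mulrBr.
  rewrite big_split sumrB /= stationary_mean -mulr_suml pi1 mul1r.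
  by rewrite subrr add0r.
have injT h : (forall x, T h x = 0) -> forall x, h x = 0.
  move=> hT x; have m0 : mean pi h = 0.
    by rewrite -meanT /mean big1 // => y _; rewrite hT mulr0.
  have hh z : \sum_y P z y * h y = h z.
    by move: (hT z); rewrite /T m0 addr0 => /eqP; rewrite subr_eq0 => /eqP <-.
  rewrite -[LHS]mul1r -pi1 mulr_suml -[RHS]m0; apply: eq_bigr => y _.
  by rewrite (harmonic_const x y hh).
pose F (v : 'rV[R]_n) (x : X) := v 0 (enum_rank x).
(* Functions are row vectors multiplied by [A] on the right, so the entry at [i], [j] is the
   coefficient of [h] at [i] in [T h] at [j]. *)
pose A : 'M[R]_n := \matrix_(i, j) ((i == j)%:R - P (enum_val j) (enum_val i)
   + pi (enum_val i)).
have FA v j : (v *m A) 0 j = T (F v) (enum_val j).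
  rewrite mxE /T.
  transitivity (\sum_i (v 0 i * (i == j)%:R
     - P (enum_val j) (enum_val i) * v 0 i + pi (enum_val i) * v 0 i)).
    by apply: eq_bigr => i _; rewrite mxE; ring.
  rewrite big_split sumrB /=; congr (_ - _ + _).
  - rewrite (bigD1 j) //= eqxx mulr1 big1 ?addr0 /F ?enum_valK //.
    by move=> i /negPf ->; rewrite mulr0.
  - rewrite (reindex _ (onW_bij _ (@enum_val_bij X))) /=.
    by apply: eq_bigr => i _; rewrite /F enum_valK.
  - rewrite /mean (reindex _ (onW_bij _ (@enum_val_bij X))) /=.
    by apply: eq_bigr => i _; rewrite /F enum_valK.
have uA : A \in unitmx.
  rewrite -row_free_unit -kermx_eq0; apply/eqP/row_matrixP => i.
  rewrite row0; apply/rowP => j; rewrite [RHS]mxE.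
  have := injT (F (row i (kermx A))) _ (enum_val j).
  rewrite /F enum_valK; apply => x.
  by rewrite -(enum_rankK x) -FA -row_mul mulmx_ker !mxE.
pose h := F ((\row_j g (enum_val j)) *m invmx A).
have Th x : T h x = g x.
  by rewrite -(enum_rankK x) -FA mulmxKV // mxE enum_rankK.
exists h => x; have -> : mean pi g = mean pi h.
  by rewrite -(meanT h); apply: eq_bigr => y _; rewrite Th.
by rewrite -Th /T addrK.
Qed.

End DirichletForm.

(** * Unnormalised Poisson weights [exp_coeff t m] and their second moment *)

Section PoissonWeights.
Variable R : realType.
Implicit Types t : R.

Lemma exp_coeffS t n : n.+1%:R * exp_coeff t n.+1 = t * exp_coeff t n.
Proof.
rewrite /exp_coeff /= factS natrM exprS.
have h1 : n.+1%:R != 0 :> R by rewrite pnatr_eq0.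
have h2 : n`!%:R != 0 :> R by rewrite pnatr_eq0 -lt0n fact_gt0.
by field; rewrite h2 addrC natr1 h1.
Qed.

Lemma cvg_nat_exp_coeff t : n%:R * exp_coeff t n @[n --> \oo] --> (0 : R).
Proof.
rewrite -cvg_shiftS /=.
rewrite (_ : (fun n => _) = fun n => t * exp_coeff t n); last first.
  by apply/funext => n; rewrite exp_coeffS.
by have := cvgMl_tmp (a := t) (@cvg_exp_coeff R t); rewrite mulr0; apply.
Qed.

(** The truncated variance has a closed form whose last term vanishes in the limit, leaving the
    Poisson variance [t] times the total mass [expR t]. *)
Lemma sum_exp_coeff_variance t n :
  \sum_(0 <= m < n) exp_coeff t m * (m%:R - t) ^+ 2 =
  t * (\sum_(0 <= m < n) exp_coeff t m) + n%:R * exp_coeff t n * (t - n%:R).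
Proof.
elim: n => [|n IH]; first by rewrite !big_geq // mulr0 !mul0r addr0.
rewrite !big_nat_recr //= IH exp_coeffS -natr1; ring.
Qed.

Lemma cvg_sum_exp_coeff t :
  \sum_(0 <= m < n) exp_coeff t m @[n --> \oo] --> expR t.
Proof. exact: is_cvg_series_exp_coeff. Qed.

Lemma cvg_sum_exp_coeff_variance t :
  \sum_(0 <= m < n) exp_coeff t m * (m%:R - t) ^+ 2 @[n --> \oo]
    --> t * expR t.
Proof.
have h0 : n%:R * exp_coeff t n * (t - n%:R) @[n --> \oo] --> (0 : R).
  rewrite -cvg_shiftS /=.
  rewrite (_ : (fun n => _) = fun n => t * (t - 1) * exp_coeff t n
      - t * (n%:R * exp_coeff t n)); last first.
    by apply/funext => n; rewrite exp_coeffS -natr1; ring.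
  have := cvgB (cvgMl_tmp (a := t * (t - 1)) (@cvg_exp_coeff R t))
    (cvgMl_tmp (a := t) (@cvg_nat_exp_coeff t)).
  by rewrite !mulr0 subrr; apply.
under eq_fun do rewrite sum_exp_coeff_variance.
have := cvgD (cvgMl_tmp (a := t) (@cvg_sum_exp_coeff t)) h0.
by rewrite addr0; apply.
Qed.

End PoissonWeights.

(** * The heat kernel as a Poisson mixture of kernel powers *)

Section HeatKernel.
Variables (R : realType) (X : finType) (P : X -> X -> R).
Hypothesis hP : stochastic P.
Implicit Types t : R.

Lemma cvg_heat_kernel t x y : 0 <= t ->
  \sum_(0 <= m < n) exp_coeff t m * kernel_pow P m x y @[n --> \oo]
    --> expR t * heat_kernel P t x y.
Proof.
move=> t0; rewrite /heat_kernel mulrA -expRD subrr expR0 mul1r.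
apply: (@series_le_cvg _ (fun m => exp_coeff t m * kernel_pow P m x y)
  (exp_coeff t)); last exact: is_cvg_series_exp_coeff.
- by move=> n; rewrite mulr_ge0 ?exp_coeff_ge0 ?kernel_pow_ge0.
- by move=> n; exact: exp_coeff_ge0.
- by move=> n; rewrite ler_piMr ?exp_coeff_ge0 ?kernel_pow_le1.
Qed.

Lemma cvg_heat_sum t x (g : X -> R) : 0 <= t ->
  \sum_(0 <= m < n) exp_coeff t m * (\sum_z kernel_pow P m x z * g z)
    @[n --> \oo] --> expR t * \sum_z heat_kernel P t x z * g z.
Proof.
move=> t0.
rewrite (_ : (fun n => _) = fun n => \sum_z
    (\sum_(0 <= m < n) exp_coeff t m * kernel_pow P m x z) * g z); last first.
  apply/funext => n; under [RHS]eq_bigr do rewrite mulr_suml.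
  rewrite exchange_big /=; apply: eq_bigr => m _.
  by rewrite mulr_sumr; apply: eq_bigr => z _; rewrite mulrA.
rewrite mulr_sumr; apply: cvg_big => [|z _]; first exact: add_continuous.
by rewrite mulrA; apply: cvgMr_tmp; exact: cvg_heat_kernel.
Qed.

Lemma heat_kernel_sum1 t x : 0 <= t -> \sum_y heat_kernel P t x y = 1.
Proof.
move=> t0; have := cvg_heat_sum (x := x) (g := fun=> 1) t0.
under eq_fun do under eq_bigr do
  (under eq_bigr do rewrite mulr1; rewrite kernel_pow_sum1 // mulr1).
move=> /cvg_lim; have /cvg_lim -> // := @cvg_sum_exp_coeff R t.
move=> /(_ (@Rhausdorff R)) e.
have := expR_gt0 t; rewrite lt0r => /andP[t1 _].
apply: (mulfI t1); rewrite mulr1 [RHS]e //.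
by congr (_ * _); apply: eq_bigr => y _; rewrite mulr1.
Qed.

(* The number of jumps before time [t] is Poisson of mean and variance [t]. *)
Lemma heat_sum_le t x (g : X -> R) : 0 <= t ->
  (forall m, \sum_z kernel_pow P m x z * g z <= (m%:R - t) ^+ 2) ->
  \sum_z heat_kernel P t x z * g z <= t.
Proof.
move=> t0 hg; rewrite -(ler_pM2l (expR_gt0 t)) [leRHS]mulrC.
apply: (ler_cvg_to (cvg_heat_sum (x := x) (g := g) t0)
  (@cvg_sum_exp_coeff_variance R t)).
near=> n; apply: ler_sum => m _.
by rewrite ler_wpM2l ?exp_coeff_ge0.
Unshelve. all: by end_near.
Qed.

(* Abel summation turns the increments of [P^m h] into increments of the
   Poisson weights [w_m], and [w_m - w_(m - 1) = w_m * (1 - m / t)]. *)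
Lemma sum_exp_coeff_abel (t : R) (a : nat -> R) n :
  t * (\sum_(0 <= m < n) exp_coeff t m * (a m - a m.+1)) =
  \sum_(0 <= m < n) exp_coeff t m * (t - m%:R) * a m
    - n%:R * exp_coeff t n * a n.
Proof.
elim: n => [|n IH]; first by rewrite !big_geq // mulr0 !mul0r subrr.
rewrite !big_nat_recr //= mulrDr IH exp_coeffS; ring.
Qed.

(** For g = h - P h the terms P^m g telescope, so Abel summation leaves the weights |t - m| / t
    under the Poisson law, and the mean of |t - m| is at most sqrt t. *)
Lemma heat_sum_coboundary_le t x (g h : X -> R) (H : R) : 0 < t ->
  (forall z, `|h z| <= H) ->
  (forall z, g z = h z - \sum_y P z y * h y) ->
  `|\sum_z heat_kernel P t x z * g z| <= H / Num.sqrt t.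
Proof.
move=> t0 hH hg; set s := Num.sqrt t.
have s0 : 0 < s by rewrite sqrtr_gt0.
have st : s ^+ 2 = t by rewrite sqr_sqrtr // ltW.
have H0 : 0 <= H by apply: le_trans (hH x); exact: normr_ge0.
pose a m := \sum_z kernel_pow P m x z * h z.
have ag m : \sum_z kernel_pow P m x z * g z = a m - a m.+1.
  rewrite /a; under [X in _ - X]eq_bigr do rewrite kernel_powSr // mulr_suml.
  rewrite exchange_big -sumrB; apply: eq_bigr => z _.
  rewrite hg mulrBr mulr_sumr; congr (_ - _).
  by apply: eq_bigr => y _; rewrite mulrA.
have aH m : `|a m| <= H.
  apply: le_trans (ler_norm_sum _ _ _) _.
  rewrite -[leRHS]mul1r -(kernel_pow_sum1 hP m x) mulr_suml.
  apply: ler_sum => z _.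
  by rewrite normrM ger0_norm ?kernel_pow_ge0 // ler_wpM2l ?kernel_pow_ge0.
(* AM-GM stands in for Cauchy-Schwarz: after averaging, the right-hand side becomes (t + t) / (2 s)
   = s. *)
have bound m : `|t - m%:R| <= (s ^+ 2 + (m%:R - t) ^+ 2) * (2 * s)^-1.
  rewrite ler_pdivlMr ?mulr_gt0 //.
  have -> : (m%:R - t) ^+ 2 = `|t - m%:R| ^+ 2.
    by rewrite real_normK ?num_real // -sqrrN opprB.
  rewrite -subr_ge0; set u := `|_|.
  by rewrite (_ : _ - _ = (s - u) ^+ 2) ?sqr_ge0 //; ring.
have cL := cvg_norm (cvgMl_tmp (a := t)
  (cvg_heat_sum (x := x) (g := g) (ltW t0))).
have cR : (\sum_(0 <= m < n) exp_coeff t m * s ^+ 2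
    + \sum_(0 <= m < n) exp_coeff t m * (m%:R - t) ^+ 2) * (2 * s)^-1 * H
    + n%:R * exp_coeff t n * H @[n --> \oo]
    --> (expR t * s ^+ 2 + t * expR t) * (2 * s)^-1 * H + 0 * H.
  apply: cvgD; apply: cvgMr_tmp; last exact: cvg_nat_exp_coeff.
  apply: cvgMr_tmp; apply: cvgD; last exact: cvg_sum_exp_coeff_variance.
  under eq_fun do rewrite -mulr_suml.
  by apply: cvgMr_tmp; exact: cvg_sum_exp_coeff.
have : `|t * (expR t * \sum_z heat_kernel P t x z * g z)| <=
    (expR t * s ^+ 2 + t * expR t) * (2 * s)^-1 * H + 0 * H.
  apply: (ler_cvg_to (cL _ _) cR); near=> n; cbv beta.
  under eq_bigr do rewrite ag.
  rewrite sum_exp_coeff_abel; apply: le_trans (ler_normB _ _) _.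
  have w0 m : 0 <= exp_coeff t m by rewrite exp_coeff_ge0 // ltW.
  have nw0 : 0 <= n%:R * exp_coeff t n by exact: mulr_ge0.
  apply: lerD; last by rewrite normrM (ger0_norm nw0) ler_wpM2l.
  rewrite -big_split /= !mulr_suml; apply: le_trans (ler_norm_sum _ _ _) _.
  apply: ler_sum => m _; rewrite normrM ler_pM // normrM (ger0_norm (w0 m)).
  by rewrite -mulrDr -mulrA ler_wpM2l.
rewrite !normrM (gtr0_norm t0) (gtr0_norm (expR_gt0 t)) mul0r addr0 => hle.
rewrite -(ler_pM2l (mulr_gt0 t0 (expR_gt0 t))) -mulrA.
apply: le_trans hle _; rewrite -st le_eqVlt; apply/orP; left; apply/eqP.
by field; rewrite gt_eqF.
Unshelve. all: by end_near.
Qed.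

End HeatKernel.

(** With equal total masses, the excess on [B] equals the deficit off [B], so it is at most half of
    the l1 distance. *)
Lemma tv_dist_event (R : realType) (X : finType) (mu nu : X -> R) (B : pred X) :
  \sum_x mu x = \sum_x nu x ->
  \sum_(x | B x) mu x <= \sum_(x | B x) nu x + tv_dist mu nu.
Proof.
rewrite /tv_dist !(bigID B xpredT) /= => e.
have h1 : \sum_(x | B x) mu x - \sum_(x | B x) nu x
    <= \sum_(x | B x) `|mu x - nu x|.
  by rewrite -sumrB; apply: ler_sum => x _; exact: ler_norm.
have h2 : \sum_(x | ~~ B x) nu x - \sum_(x | ~~ B x) mu x
    <= \sum_(x | ~~ B x) `|mu x - nu x|.
  by rewrite -sumrB; apply: ler_sum => x _; rewrite distrC; exact: ler_norm.
lra.
Qed.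

(** * Mixing times and the mean distance from a point *)

Section Mixing.
Variables (R : realType) (X : finType) (P : X -> X -> R) (pi : X -> R).
Hypothesis hP : stochastic P.
Hypothesis irr : irreducible P.
Hypothesis hpi : stationary_distribution P pi.
Variable eps : R.

(** Poisson's equation for each point indicator [g y] bounds every entry of the heat kernel minus
    [pi] by a multiple of 1 / sqrt t. *)
Lemma heat_kernel_mixes : 0 < eps -> exists2 t, 0 <= t &
  \big[Num.max/0]_(x : X) tv_dist (heat_kernel P t x) pi <= eps.
Proof.
move=> eps0; pose g (y x : X) : R := (y == x)%:R.
have /choice [h hh] y := poisson_equation hP irr hpi (g y).
pose S := \sum_y \sum_z `|h y z|.
have S0 : 0 <= S by apply: sumr_ge0 => y _; exact: sumr_ge0.
have s0 : 0 < S / eps + 1 by rewrite ltr_wpDl // divr_ge0 // ltW.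
(* This gives S / sqrt t <= eps; the added 1 keeps [t] positive even if [S] is 0. *)
exists ((S / eps + 1) ^+ 2); first exact: sqr_ge0.
set t := _ ^+ 2.
have t0 : 0 < t by rewrite exprn_gt0.
apply: bigmax_le => [|x _]; first exact: ltW.
have meang y : mean pi (g y) = pi y.
  by rewrite /mean; under eq_bigr do rewrite mulrC; exact: sum_delta.
have hy y : `|heat_kernel P t x y - pi y| <= (\sum_z `|h y z|) / (S / eps + 1).
  have -> : heat_kernel P t x y - pi y =
      \sum_z heat_kernel P t x z * (g y z - mean pi (g y)).
    under eq_bigr do rewrite mulrBr.
    rewrite sumrB -mulr_suml heat_kernel_sum1 ?ltW // mul1r meang.
    by congr (_ - _); under [RHS]eq_bigr do rewrite mulrC; rewrite sum_delta.
  have -> : S / eps + 1 = Num.sqrt t by rewrite sqrtr_sqr ger0_norm // ltW.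
  apply: (heat_sum_coboundary_le hP x t0 _ (hh y)) => z.
  by rewrite (bigD1 z) //= lerDl sumr_ge0.
apply: (@le_trans _ _ (\sum_y `|heat_kernel P t x y - pi y|)).
  rewrite /tv_dist ler_piMl ?invf_le1 ?ler1n //.
  by apply: sumr_ge0 => y _; exact: normr_ge0.
apply: le_trans (ler_sum _ (fun y _ => hy y)) _.
rewrite -mulr_suml -/S ler_pdivrMr // mulrDr mulr1 mulrCA divff ?gt_eqF //.
by rewrite mulr1 lerDl ltW.
Qed.

(** Chebyshev for the jump count: a point reached after [m] jumps is at distance at most [m], so a
    distance of at least [t + a] forces [a <= m - t]. *)
Lemma heat_kernel_far (t a : R) x : 0 <= t -> 0 <= a ->
  (\sum_(z | t + a <= (dist irr x z)%:R) heat_kernel P t x z) * a ^+ 2 <= t.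
Proof.
move=> t0 a0; pose g z : R := (t + a <= (dist irr x z)%:R)%R%:R * a ^+ 2.
have -> : (\sum_(z | t + a <= (dist irr x z)%:R) heat_kernel P t x z) * a ^+ 2
    = \sum_z heat_kernel P t x z * g z.
  rewrite mulr_suml big_mkcond; apply: eq_bigr => z _.
  by rewrite /g; case: ifP; rewrite ?mul1r // mul0r mulr0.
apply: (heat_sum_le hP t0) => m.
rewrite -[leRHS]mul1r -[X in _ <= X * _](kernel_pow_sum1 hP m x) mulr_suml.
apply: ler_sum => z _; have := kernel_pow_ge0 hP m x z.
rewrite le_eqVlt => /orP[/eqP <-|Pm]; first by rewrite !mul0r.
rewrite ler_wpM2l ?(ltW Pm) // /g; case: (leP (t + a)) => h; last first.
  by rewrite mulr0n mul0r sqr_ge0.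
have := dist_le irr Pm; rewrite -(ler_nat R) mulr1n mul1r => hm.
by rewrite ler_sqr ?nnegrE; lra.
Qed.

Lemma var_dist_le x :
  var pi (fun z => (dist irr x z)%:R) <= trel P pi * ((kconst irr)%:R ^+ 2 / 2).
Proof.
apply: le_trans (var_le_trel hP irr hpi _) _.
rewrite ler_wpM2l ?(trel_ge0 hP irr hpi) //.
by apply: (dirichlet_le hP hpi) => z w Pzw; exact: dist_lipschitz.
Qed.

Lemma chebyshev_lower (f : X -> R) c : 0 <= c ->
  (\sum_(z | f z < mean pi f - c) pi z) * c ^+ 2 <= var pi f.
Proof.
move=> c0; have [pi0 _ _] := hpi.
rewrite /var mulr_suml big_mkcond /=; apply: ler_sum => z _.
case: ifP => hz; last by rewrite mulr_ge0 ?sqr_ge0.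
rewrite ler_wpM2l // -[leRHS]sqrrN opprB ler_sqr ?nnegrE; lra.
Qed.

(** Widening a Chebyshev threshold by [d] makes the bound strict, also when [a] is 0. *)
Let gap_lt (u q a d : R) : 0 < q -> 0 <= a -> 0 < d ->
  u * (a + d) ^+ 2 <= q * a ^+ 2 -> u < q.
Proof.
move=> q0 a0 d0 h; rewrite ltNge; apply/negP => qu.
have : q * a ^+ 2 < u * (a + d) ^+ 2; last by rewrite ltNge h.
apply: (@lt_le_trans _ _ (q * (a + d) ^+ 2)).
  by rewrite ltr_pM2l // ltr_sqr ?nnegrE; lra.
by rewrite ler_wpM2r ?sqr_ge0.
Qed.

(* Two Chebyshev inequalities: if the mean were larger, then the walk started
   at [x] would be far from [x] with probability less than [(1 - eps) / 2] at
   time [t], while points close to [x] would have stationary mass less than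
   [(1 - eps) / 2]. *)
Lemma mean_dist_le (t : R) x : eps < 1 -> 0 <= t ->
  tv_dist (heat_kernel P t x) pi <= eps ->
  mean pi (fun z => (dist irr x z)%:R) <=
    t + Num.sqrt (2 * t / (1 - eps))
    + (kconst irr)%:R * Num.sqrt (trel P pi / (1 - eps)).
Proof.
move=> eps1 t0 htv; set f := fun z => _; set k := (kconst irr)%:R.
have q0 : 0 < 1 - eps by rewrite subr_gt0.
set a := Num.sqrt _; set b := k * _; rewrite leNgt; apply/negP => hm.
have a0 : 0 <= a by exact: sqrtr_ge0.
have b0 : 0 <= b by rewrite mulr_ge0 ?sqrtr_ge0 ?ler0n.
(* [a] and [b] are the thresholds for which Chebyshev's bound is exactly [(1 - eps) / 2]. *)
have a2 : (1 - eps) / 2 * a ^+ 2 = t.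
  rewrite sqr_sqrtr; first by field; rewrite gt_eqF.
  by rewrite divr_ge0 ?mulr_ge0 // ltW.
have b2 : (1 - eps) / 2 * b ^+ 2 = trel P pi * (k ^+ 2 / 2).
  rewrite exprMn sqr_sqrtr; first by field; rewrite gt_eqF.
  by rewrite divr_ge0 ?(trel_ge0 hP irr hpi) // ltW.
(* Half of the excess goes to each threshold, so that both tails are cut at the same level
   [t + (a + d)]. *)
pose d := (mean pi f - (t + a + b)) / 2.
have d0 : 0 < d by rewrite divr_gt0 // subr_gt0.
have md : mean pi f - (b + d) = t + (a + d) by rewrite /d; lra.
have q20 : 0 < (1 - eps) / 2 by rewrite divr_gt0.
have ad0 : 0 <= a + d by rewrite addr_ge0 // ltW.
have bd0 : 0 <= b + d by rewrite addr_ge0 // ltW.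
have := heat_kernel_far x t0 ad0; rewrite -{3}a2 => /(gap_lt q20 a0 d0) far.
have := chebyshev_lower f bd0; rewrite md => near0.
have := le_trans near0 (var_dist_le x); rewrite -b2.
move=> /(gap_lt q20 b0 d0) near.
have := heat_kernel_sum1 hP x t0.
rewrite (bigID (fun z => t + (a + d) <= f z)) /=.
under [X in _ + X = _]eq_bigl do rewrite -ltNge.
(* Below the cut the heat kernel has mass above [(1 + eps) / 2] and [pi] has mass below
   [(1 - eps) / 2], a gap larger than [eps]. *)
have := @tv_dist_event _ _ (heat_kernel P t x) pi
  (fun z => f z < t + (a + d)).
rewrite heat_kernel_sum1 //; case: hpi => _ -> _ => /(_ erefl) tv e.
move: far near tv e htv; rewrite -/f; lra.
Qed.

(** To avoid proving that the infimum is attained, [mean_dist_le] is applied at a mixed time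
    slightly above [tmix P pi eps], and continuity of the square root closes the gap. *)
Lemma mean_dist_le_tmix x : 0 < eps -> eps < 1 ->
  mean pi (fun z => (dist irr x z)%:R) <=
    tmix P pi eps + Num.sqrt (2 * tmix P pi eps / (1 - eps))
    + (kconst irr)%:R * Num.sqrt (trel P pi / (1 - eps)).
Proof.
move=> eps0 eps1; set M := mean _ _; set c := (kconst irr)%:R * _.
set T := tmix P pi eps.
have hinf : has_inf [set t : R | 0 <= t /\
    \big[Num.max/0]_(x : X) tv_dist (heat_kernel P t x) pi <= eps].
  split; last by exists 0 => t [].
  by have [t t0 ht] := heat_kernel_mixes eps0; exists t.
have T0 : 0 <= T by apply: lb_le_inf; [case: hinf | move=> t []].
set q := Num.sqrt (2 / (1 - eps)).
have q0 : 0 <= q by exact: sqrtr_ge0.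
have sq (r : R) : 0 <= r -> Num.sqrt (2 * r / (1 - eps)) = q * Num.sqrt r.
  by move=> r0; rewrite mulrAC sqrtrM // divr_ge0 // subr_ge0 ltW.
rewrite leNgt; apply/negP => hM.
pose r := M - (T + Num.sqrt (2 * T / (1 - eps)) + c).
have r0 : 0 < r by rewrite subr_gt0.
(* For t < T + e^2 one has sqrt t <= sqrt T + e, and e^2 <= e since e <= 1; the total loss is thus
   below [e * (1 + q)], hence below [r]. *)
pose e := Num.min 1 (r / (1 + q)).
have q10 : 0 < 1 + q by rewrite ltr_pwDl.
have e0 : 0 < e by rewrite lt_min ltr01 divr_gt0.
have e1 : e <= 1 by rewrite ge_min lexx.
have er : e * (1 + q) <= r by rewrite -ler_pdivlMr // ge_min lexx orbT.
have e20 : 0 < e ^+ 2 by rewrite exprn_gt0.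
have [t [t0 ht] tT] := inf_adherent e20 hinf.
have htv : tv_dist (heat_kernel P t x) pi <= eps.
  by apply: le_trans ht; exact: le_bigmax.
have := mean_dist_le eps1 t0 htv; rewrite -/M -/c !sq // => hle.
have hs : Num.sqrt t <= Num.sqrt T + e.
  have u0 : 0 <= Num.sqrt T by exact: sqrtr_ge0.
  rewrite -[leRHS]ger0_norm ?addr_ge0 ?(ltW e0) // -sqrtr_sqr ler_wsqrtr //.
  apply: le_trans (ltW tT) _; rewrite sqrrD sqr_sqrtr // -/T addrAC lerDl.
  by rewrite mulrn_wge0 // mulr_ge0 // ltW.
have hqs : q * Num.sqrt t <= q * Num.sqrt T + q * e.
  by rewrite -mulrDr ler_wpM2l.
have ee : e ^+ 2 <= e by rewrite expr2 ler_piMl // ltW.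
move: er; rewrite /r sq // => er; rewrite -/T in tT.
nra.
Qed.

End Mixing.

(** * Averaging the triangle inequality over the stationary law *)

Theorem proposition2p9 (R : realType) (X : finType) (P : X -> X -> R)
    (pi : X -> R) (hX : (2 <= #|X|)%N) (hP : stochastic P)
    (irr : irreducible P) (hpi : stationary_distribution P pi)
    (eps : R) (heps0 : 0 < eps) (heps1 : eps < 1) :
  (chain_diam irr)%:R <=
    (1 + (kconst irr)%:R) *
      (tmix P pi eps + Num.sqrt (2 * tmix P pi eps / (1 - eps))
       + (kconst irr)%:R * Num.sqrt (trel P pi / (1 - eps))).
Proof.
have X2 : (0 < #|{: X * X}|)%N by rewrite card_prod muln_gt0 !(ltnW hX).
have [[x y] e] :=
  bigop.eq_bigmax (fun xy : X * X => dist irr xy.1 xy.2) X2.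
rewrite /chain_diam e /=; set M := _ + _ + _.
have hM z : mean pi (fun w => (dist irr z w)%:R) <= M.
  exact: mean_dist_le_tmix.
have [pi0 pi1 _] := hpi.
apply: (@le_trans _ _ (mean pi (fun z => (dist irr x z)%:R)
    + (kconst irr)%:R * mean pi (fun z => (dist irr y z)%:R))).
  rewrite -[leLHS]mul1r -[X in X * _ <= _]pi1 mulr_suml /mean mulr_sumr.
  rewrite -big_split /=.
  apply: ler_sum => z _; rewrite mulrCA -mulrDr ler_wpM2l //.
  rewrite -natrM -natrD ler_nat.
  (* The leg from [z] to [y] is reversed so that both averaged distances start at a fixed point. *)
  apply: leq_trans (dist_triangle hP irr z x y) _.
  by rewrite leq_add2l dist_reverse.
by rewrite mulrDl mul1r lerD // ler_wpM2l.
Qed.
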